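(* Let $n\ge 2$ and let $\rho:\mathcal{B}_n\to GL(V)$ be any completely reducible finite-dimensional complex representation of the braid group $\mathcal{B}_n$ (for example, any unitary or irreducible representation). Then there exists $D\in \mathrm{End}_{\mathcal{B}_n}(V)$ (i.e. a linear endomorphism of $V$ commuting with all $\rho(\sigma_i)$, $1\le i\le n-1$) such that keeping $\rho(\sigma_1),\dots,\rho(\sigma_{n-1})$ and defining $$\rho(\tau)=D\,\rho(\gamma),\qquad \rho(\sigma_n)=\rho(\gamma)\rho(\sigma_{n-1})\rho(\gamma^{-1})$$ gives a representation of the necklace braid group $\mathcal{NB}_n$ on $V$.
   Context: The braid group $\mathcal{B}_n$ is generated by $\sigma_1,\dots,\sigma_{n-1}$ with relations $\sigma_i\sigma_{i+1}\sigma_i=\sigma_{i+1}\sigma_i\sigma_{i+1}$ and $\sigma_i\sigma_j=\sigma_j\sigma_i$ for $|i-j|>1$. Put $\gamma=\sigma_1\sigma_2\cdots\sigma_{n-1}\in\mathcal{B}_n$. The necklace braid group $\mathcal{NB}_n$ is the group with generators $\sigma_1,\dots,\sigma_n,\tau$ and relations, with all indices taken modulo $n$: (B1) $\sigma_i\sigma_{i+1}\sigma_i=\sigma_{i+1}\sigma_i\sigma_{i+1}$ for all $i$; (B2) $\sigma_i\sigma_j=\sigma_j\sigma_i$ whenever $i-j\not\equiv\pm1\pmod n$; (N1) $\tau\sigma_i\tau^{-1}=\sigma_{i+1}$ for $1\le i\le n$; (N2) $\tau^{2n}=1$. *)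

(* Defs.v *)
From HB Require Import structures.
From mathcomp Require Import all_boot all_order all_algebra.
From mathcomp Require Import generic_quotient.
From mathcomp Require Import boolp reals.
From mathcomp Require Export complex.

Set Implicit Arguments.
Unset Strict Implicit.
Unset Printing Implicit Defensive.

Import Order.TTheory GRing.Theory Num.Theory.

Local Open Scope group_scope.
Local Open Scope quotient_scope.

(** * Groups given by generators and relations *)

(* A word in the generators [T] and their inverses; [(x, true)] stands for [x]
   and [(x, false)] for its inverse. *)
Definition word (T : Type) := seq (T * bool).

Definition letter (T : Type) (x : T) : T * bool := (x, true).
Definition letterV (T : Type) (x : T) : T * bool := (x, false).

Definition word_inv (T : Type) (w : word T) : word T :=
  rev [seq (a.1, ~~ a.2) | a <- w].

Lemma word_inv_cons (T : Type) (a : T * bool) (w : word T) :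
  word_inv (a :: w) = word_inv w ++ [:: (a.1, ~~ a.2)].
Proof. by rewrite /word_inv /= rev_cons cats1. Qed.

Lemma word_invK (T : Type) : involutive (@word_inv T).
Proof.
move=> w; rewrite /word_inv map_rev revK -map_comp -[RHS]map_id.
by apply: eq_map => -[x b] /=; rewrite negbK.
Qed.

(* The congruence on words generated by free cancellation and by the relations
   [u = v] for all [u], [v] such that [r u v]. *)
Inductive pres_eq (T : Type) (r : word T -> word T -> Prop) :
    word T -> word T -> Prop :=
| PresRel u v : r u v -> pres_eq r u v
| PresCancel a : pres_eq r [:: a; (a.1, ~~ a.2)] [::]
| PresRefl u : pres_eq r u u
| PresSym u v : pres_eq r u v -> pres_eq r v u
| PresTrans u v w : pres_eq r u v -> pres_eq r v w -> pres_eq r u w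
| PresCat u u' v v' :
    pres_eq r u u' -> pres_eq r v v' -> pres_eq r (u ++ v) (u' ++ v').

Section PresentedGroup.
Variables (T : choiceType) (r : word T -> word T -> Prop).
Implicit Types u v w : word T.

Definition pres_eqb : rel (word T) := fun u v => `[< pres_eq r u v >].

Lemma pres_eqb_refl : reflexive pres_eqb.
Proof. by move=> u; apply/asboolP; apply: PresRefl. Qed.

Lemma pres_eqb_sym : symmetric pres_eqb.
Proof. by move=> u v; apply/asboolP/asboolP; apply: PresSym. Qed.

Lemma pres_eqb_trans : transitive pres_eqb.
Proof.
move=> v u w /asboolP uv /asboolP vw; apply/asboolP.
exact: PresTrans uv vw.
Qed.

Canonical pres_equiv :=
  EquivRel pres_eqb pres_eqb_refl pres_eqb_sym pres_eqb_trans.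

Definition presented := {eq_quot pres_equiv}.
HB.instance Definition _ := Choice.on presented.

Definition pres_class w : presented := \pi_{eq_quot pres_equiv} w.

Lemma pres_classP u v : pres_class u = pres_class v <-> pres_eq r u v.
Proof.
rewrite /pres_class; split; first by move=> /eqmodP /asboolP.
by move=> uv; apply/eqmodP/asboolP.
Qed.

Definition pres_repr (x : presented) : word T := @repr _ {eq_quot pres_equiv} x.

Lemma pres_class_repr (x : presented) : pres_class (pres_repr x) = x.
Proof. exact: reprK. Qed.

Lemma pres_eq_invr w : pres_eq r (w ++ word_inv w) [::].
Proof.
elim: w => [|a w IHw]; first exact: PresRefl.
rewrite word_inv_cons -cat1s -catA (catA w).
apply: PresTrans (PresCancel r a).
apply: (@PresCat _ _ [:: a] [:: a] _ [:: _]); first exact: PresRefl.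
by apply: (@PresCat _ _ _ [::] _ [:: _] IHw); apply: PresRefl.
Qed.

Lemma pres_eq_invl w : pres_eq r (word_inv w ++ w) [::].
Proof. by have := pres_eq_invr (word_inv w); rewrite word_invK. Qed.

Lemma pres_eq_inv u v : pres_eq r u v -> pres_eq r (word_inv u) (word_inv v).
Proof.
move=> uv; apply: (@PresTrans _ _ _ (word_inv u ++ (v ++ word_inv v))).
  rewrite -[X in pres_eq _ X]cats0; apply: PresCat; first exact: PresRefl.
  exact/PresSym/pres_eq_invr.
rewrite catA -[X in pres_eq _ _ X]cat0s; apply: PresCat; last exact: PresRefl.
apply: PresTrans (pres_eq_invl u).
by apply: PresCat; [apply: PresRefl | apply: PresSym].
Qed.

Definition pres_mul (x y : presented) : presented :=
  pres_class (pres_repr x ++ pres_repr y).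
Definition pres_one : presented := pres_class [::].
Definition pres_inv (x : presented) : presented :=
  pres_class (word_inv (pres_repr x)).

Lemma pres_mulE u v :
  pres_mul (pres_class u) (pres_class v) = pres_class (u ++ v).
Proof.
by apply/pres_classP/PresCat; apply/pres_classP; rewrite pres_class_repr.
Qed.

Lemma pres_invE u : pres_inv (pres_class u) = pres_class (word_inv u).
Proof. by apply/pres_classP/pres_eq_inv/pres_classP; rewrite pres_class_repr. Qed.

Lemma pres_mulA : associative pres_mul.
Proof.
move=> x y z; rewrite -(pres_class_repr x) -(pres_class_repr y).
by rewrite -(pres_class_repr z) !pres_mulE catA.
Qed.

Lemma pres_mul1x : left_id pres_one pres_mul.
Proof. by move=> x; rewrite -(pres_class_repr x) pres_mulE. Qed.

Lemma pres_mulx1 : right_id pres_one pres_mul.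
Proof. by move=> x; rewrite -(pres_class_repr x) pres_mulE cats0. Qed.

Lemma pres_mulVx : left_inverse pres_one pres_inv pres_mul.
Proof.
move=> x; rewrite -(pres_class_repr x) pres_invE pres_mulE.
exact/pres_classP/pres_eq_invl.
Qed.

Lemma pres_mulxV : right_inverse pres_one pres_inv pres_mul.
Proof.
move=> x; have := pres_mulVx (pres_inv x).
by rewrite -(pres_class_repr x) !pres_invE word_invK.
Qed.

HB.instance Definition _ :=
  isGroup.Build presented pres_mulA pres_mul1x pres_mulx1 pres_mulVx pres_mulxV.

Definition pres_gen (x : T) : presented := pres_class [:: letter x].

End PresentedGroup.

(** * Braid groups and necklace braid groups *)

Definition braid_index (n : nat) : Type := {i : nat | 0 < i < n}.
HB.instance Definition _ n := Choice.on (braid_index n).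

Inductive braid_rel (n : nat) :
    word (braid_index n) -> word (braid_index n) -> Prop :=
| BraidRel3 (i j : braid_index n) : val j = (val i).+1 ->
    braid_rel [:: letter i; letter j; letter i] [:: letter j; letter i; letter j]
| BraidRelC (i j : braid_index n) :
    ((val i).+1 < val j) || ((val j).+1 < val i) ->
    braid_rel [:: letter i; letter j] [:: letter j; letter i].

Definition braid (n : nat) := presented (@braid_rel n).
HB.instance Definition _ n := Group.on (braid n).

(* [braid_sigma n i] is only meaningful for [0 < i < n]; it is set to [1]
   outside of this range. *)
Definition braid_sigma (n i : nat) : braid n :=
  if insub i is Some j then pres_gen (@braid_rel n) j else 1.

Definition braid_gamma (n : nat) : braid n :=
  \big[*%g/1]_(1 <= i < n) braid_sigma n i.

(* [Some i] is the index of [sigma_i] and [None] that of [tau].  The type ['Z_n]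
   is that of the integers modulo [n] only when [1 < n]. *)
Definition necklace_index (n : nat) : Type := option 'Z_n.
HB.instance Definition _ n := Choice.on (necklace_index n).

Section NecklaceRelations.
Variable n : nat.

Local Notation s i := (@letter (necklace_index n) (Some i)).
Local Notation t := (@letter (necklace_index n) None).
Local Notation tV := (@letterV (necklace_index n) None).

Inductive necklace_rel :
    word (necklace_index n) -> word (necklace_index n) -> Prop :=
| NecklaceB1 (i : 'Z_n) :
    necklace_rel [:: s i; s (i + 1)%R; s i] [:: s (i + 1)%R; s i; s (i + 1)%R]
| NecklaceB2 (i j : 'Z_n) : (i - j != 1)%R -> (i - j != -1)%R ->
    necklace_rel [:: s i; s j] [:: s j; s i]
| NecklaceN1 (i : 'Z_n) :
    necklace_rel [:: t; s i; tV] [:: s (i + 1)%R]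
| NecklaceN2 :
    necklace_rel (nseq (2 * n)%N t) [::].

End NecklaceRelations.

Definition necklace_braid (n : nat) := presented (@necklace_rel n).
HB.instance Definition _ n := Group.on (necklace_braid n).

Definition necklace_sigma (n i : nat) : necklace_braid n :=
  pres_gen (@necklace_rel n) (Some (i%:R)%R).

Definition necklace_tau (n : nat) : necklace_braid n :=
  pres_gen (@necklace_rel n) None.

(** * Linear representations *)

Section Representations.
Variables (F : fieldType) (V : vectType F) (G : groupType).
Implicit Types (rho : G -> 'End(V)) (U W : {vspace V}).

(* Since [G] is a group, such a [rho] takes its values in GL(V). *)
Definition representation rho : Prop :=
  rho 1 = \1%VF /\ forall g h : G, rho (g * h) = (rho g \o rho h)%VF.

Definition rep_stable rho U : Prop := forall g : G, (rho g @: U <= U)%VS.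

Definition rep_irreducible rho W : Prop :=
  [/\ rep_stable rho W, W != 0%VS &
      forall U, rep_stable rho U -> (U <= W)%VS -> U = 0%VS \/ U = W].

Definition completely_reducible rho : Prop :=
  exists (m : nat) (W : 'I_m -> {vspace V}),
    [/\ forall i, rep_irreducible rho (W i),
        directv (\sum_(i < m) W i)%VS &
        (\sum_(i < m) W i)%VS = fullv].

Definition rep_commutes rho (D : 'End(V)) : Prop :=
  forall g : G, (D \o rho g)%VF = (rho g \o D)%VF.

End Representations.

(* Main.v *)
Require Import Defs.
From mathcomp Require Import all_boot all_order all_algebra.
From mathcomp Require Import reals complex.
From mathcomp Require Import spectral zify.

(** The product gamma shifts the generators: gamma sigma_i = sigma_(i+1) gamma.
    Moreover gamma^2 sigma_(n-1) = sigma_1 gamma^2, so the conjugates of sigma_1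
    by the powers of gamma are n-periodic and extend sigma_1, ..., sigma_(n-1)
    to a cyclic family satisfying (B1), (B2) and, with gamma for tau, (N1).
    Periodicity also makes gamma^n central, and by Schur's lemma gamma^(2n) acts
    on each irreducible summand of V by a nonzero scalar; letting D act there by
    a 2n-th root of its inverse gives (D gamma)^(2n) = 1. *)

Set Implicit Arguments.
Unset Strict Implicit.
Unset Printing Implicit Defensive.

Import GRing.Theory Num.Theory.

(** * Powers of endomorphisms and of group elements under a representation *)

Section Representations.
Variables (F : fieldType) (V : vectType F).
Implicit Types f : 'End(V).

Definition lfun_exp f k : 'End(V) := iter k (comp_lfun f) \1%VF.

Lemma lfun_exp_comp f g k : (f \o g = g \o f)%VF ->
  (lfun_exp (f \o g) k = lfun_exp f k \o lfun_exp g k)%VF.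
Proof.
move=> fg; have gfX j : (g \o lfun_exp f j = lfun_exp f j \o g)%VF.
  elim: j => [|j IHj] /=; first by rewrite comp_lfun1l comp_lfun1r.
  by rewrite comp_lfunA -fg -!comp_lfunA IHj.
elim: k => [|k IHk] /=; first by rewrite comp_lfun1l.
by rewrite IHk -!comp_lfunA; congr (_ \o _)%VF; rewrite !comp_lfunA gfX.
Qed.

Lemma lfun_expS f k : (lfun_exp f k.+1 = lfun_exp f k \o f)%VF.
Proof.
elim: k => [|k IHk]; first by rewrite /= comp_lfun1l comp_lfun1r.
by rewrite -[LHS]/(f \o lfun_exp f k.+1)%VF {1}IHk comp_lfunA.
Qed.

Variables (G : groupType) (rho : G -> 'End(V)).
Hypothesis rhoP : representation rho.
Implicit Types g h : G.

Lemma repM g h : (rho (g * h)%g = rho g \o rho h)%VF.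
Proof. exact: rhoP.2. Qed.

Lemma repVK g v : rho g^-1%g (rho g v) = v.
Proof. by rewrite -comp_lfunE -repM mulVg rhoP.1 lfunE. Qed.

Lemma repX g k : rho (g ^+ k)%g = lfun_exp (rho g) k.
Proof.
by elim: k => [|k IHk] /=; rewrite ?expg0 ?rhoP.1 // expgS repM IHk.
Qed.

End Representations.

(** * Schur's lemma and roots of the action of a central element *)

Section CompletelyReducible.
Variables (C : numClosedFieldType) (V : vectType C).
Local Open Scope ring_scope.
Implicit Types (f D : 'End(V)) (U W : {vspace V}).

(** Over an algebraically closed field the matrix of [f] on a basis of [W] has an eigenvalue. Its
    rows hold the coordinates of the images, so a row eigenvector lists the coordinates of [w]. *)
Lemma stable_eigenvector f W :
  (f @: W <= W)%VS -> W != 0%VS ->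
  exists a w, [/\ w \in W, w != 0 & f w = a *: w].
Proof.
move=> fW nzW; have dimW_gt0 : (0 < \dim W)%N by rewrite lt0n dimv_eq0.
pose b := vbasis W; have bW i : b`_i \in W.
  case: (ltnP i (\dim W)) => ib; last by rewrite nth_default ?size_tuple ?mem0v.
  by apply/vbasis_mem/mem_nth; rewrite size_tuple.
pose A : 'M[C]_(\dim W) := \matrix_(i, j) coord b j (f b`_i).
have [a /eigenvalueP[u uA nzu]] := eigenvalue_closed A dimW_gt0.
have fb (i : 'I_(\dim W)) : f b`_i = \sum_j A i j *: b`_j.
  rewrite {1}(coord_vbasis (subvP fW _ (memv_img f (bW i)))).
  by apply: eq_bigr => j _; rewrite mxE.
exists a, (\sum_i u 0 i *: b`_i); split.
- by apply: memv_suml => i _; apply/memvZ/bW.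
- apply: contraNneq nzu => u0; apply/eqP/rowP=> i; rewrite mxE.
  by move/freeP: (basis_free (vbasisP W)); apply.
- rewrite linear_sum scaler_sumr; under eq_bigr do rewrite linearZ /= fb scaler_sumr.
  rewrite exchange_big; apply: eq_bigr => j _ /=.
  under eq_bigr do rewrite scalerA.
  rewrite -scaler_suml scalerA; congr (_ *: _).
  by move/rowP/(_ j): uA; rewrite !mxE.
Qed.

Variables (G : groupType) (rho : G -> 'End(V)).
Hypothesis rhoP : representation rho.
Implicit Types z : G.

(** Schur's lemma: as [z] is central, an eigenspace of [rho z] in [W] is stable; being nonzero, it
    is all of [W]. The eigenvalue is nonzero because [rho z] is injective. *)
Lemma rep_central_scalar W z : (forall g, commute z g) ->
  rep_irreducible rho W ->
  exists2 a, a != 0 & {in W, forall w, rho z w = a *: w}.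
Proof.
move=> zC [Wst nzW Wirr].
have [a [w [Ww nzw zw]]] := stable_eigenvector (Wst z) nzW.
have nza : a != 0.
  apply: contraNneq nzw => a0; move: zw; rewrite a0 scale0r => zw.
  by rewrite -[w](repVK rhoP z) zw linear0.
exists a => //; pose U := (W :&: lker (rho z - a *: \1)%VF)%VS.
have inU v : (v \in U) = (v \in W) && (rho z v == a *: v).
  by rewrite memv_cap memv_ker add_lfunE opp_lfunE scale_lfunE id_lfunE subr_eq0.
have Ust : rep_stable rho U.
  move=> g; apply/subvP=> _ /memv_imgP[v + ->]; rewrite !inU => /andP[Wv /eqP zv].
  rewrite (subvP (Wst g) _ (memv_img _ Wv)) /=.
  by rewrite -comp_lfunE -(repM rhoP) zC (repM rhoP) comp_lfunE zv linearZ.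
have [U0|UW] := Wirr U Ust (capvSl _ _).
  by move: (inU w); rewrite U0 memv0 Ww zw eqxx (negPf nzw).
by move=> v; rewrite -UW inU => /andP[_ /eqP].
Qed.

(** On each irreducible summand, [D] is a [k]-th root of the inverse of the scalar by which [z]
    acts. Being scalar on stable summands, it commutes with the action. *)
Lemma rep_central_root z k : (0 < k)%N -> (forall g, commute z g) ->
  completely_reducible rho ->
  exists2 D, rep_commutes rho D & (lfun_exp D k \o rho z = \1)%VF.
Proof.
move=> k_gt0 zC [m [W [Wirr Wdir Wfull]]].
have /fin_all_exists[a aP] i : exists b : C,
    b != 0 /\ {in W i, forall w, rho z w = b *: w}.
  by have [b nzb bP] := rep_central_scalar zC (Wirr i); exists b.
have Weq f1 f2 : (forall i, {in W i, f1 =1 f2}) -> f1 = f2 :> 'End(V).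
  move=> f12; apply/lfunP=> v.
  have /memv_sumP[w Ww ->] : v \in (\sum_(i < m) W i)%VS by rewrite Wfull memvf.
  by rewrite !linear_sum; apply: eq_bigr => i _; apply/f12/Ww.
pose pr := sumv_pi_for (esym Wfull).
(* A vector of [W j] is its own decomposition, and decompositions along a direct sum are unique. *)
have prW i j : {in W j, forall w, pr i w = if i == j then w else 0}.
  move=> w Ww; apply/esym.
  have : \sum_(i < m) (if i == j then w else 0) == \sum_(i < m) pr i w.
    by rewrite -big_mkcond big_pred1_eq sumv_pi_sum ?memvf.
  rewrite (directv_sum_unique Wdir) => [/forall_inP/(_ i isT)/eqP //||] l _.
    by case: eqP => [->|]; rewrite ?mem0v.
  exact: memv_sum_pi.
pose r i := k.-root (a i)^-1.
pose D : 'End(V) := \sum_i r i *: pr i.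
have DW i : {in W i, forall w, D w = r i *: w}.
  move=> w Ww; rewrite sum_lfunE (bigD1 i) //= big1 => [|j /negPf ji].
    by rewrite lfunE /= (prW _ i) // eqxx addr0.
  by rewrite lfunE /= (prW _ i) // ji scaler0.
have DXW i j : {in W i, forall w, lfun_exp D j w = r i ^+ j *: w}.
  elim: j => [|j IHj] w Ww /=; first by rewrite lfunE expr0 scale1r.
  by rewrite comp_lfunE IHj // linearZ /= (DW i) // scalerA -exprSr.
exists D => [g|]; apply: (Weq) => i w Ww; rewrite !comp_lfunE.
  have [Wst _ _] := Wirr i.
  by rewrite !(DW i) ?linearZ // (subvP (Wst g) _ (memv_img _ Ww)).
have [nza zW] := aP i.
by rewrite zW // linearZ /= (DXW i) // rootCK // scalerA divff // scale1r lfunE.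
Qed.

End CompletelyReducible.

(** * Centrality and representations, checked on generators and relations *)

Section Presented.
Variables (T : choiceType) (r : word T -> word T -> Prop).
Local Open Scope group_scope.

Lemma pres_class_cons a w :
  pres_class r (a :: w) = pres_class r [:: a] * pres_class r w.
Proof. exact/esym/(pres_mulE r [:: a]). Qed.

Lemma pres_class_cons2 a b w :
  pres_class r [:: a, b & w] = pres_class r [:: a] * pres_class r (b :: w).
Proof. exact: pres_class_cons. Qed.

Lemma commute_presented (z : presented r) :
  (forall x, commute z (pres_gen r x)) -> forall g, commute z g.
Proof.
move=> zC g; rewrite -(pres_class_repr g).
elim: (pres_repr g) => [|[x b] w IHw]; first exact: commute1.
rewrite pres_class_cons.
apply: commuteM => //; case: b; first exact: zC.
rewrite -[pres_class _ _]/(pres_class r (word_inv [:: letter x])) -pres_invE.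
exact/commuteV/zC.
Qed.

Variables (F : fieldType) (V : vectType F) (f : T * bool -> 'End(V)).

Definition word_eval (w : word T) : 'End(V) :=
  foldr (fun a g => f a \o g)%VF \1%VF w.

Lemma word_eval_cat u v :
  word_eval (u ++ v) = (word_eval u \o word_eval v)%VF.
Proof.
by elim: u => [|a u /= ->]; rewrite ?comp_lfun1l // comp_lfunA.
Qed.

(** Evaluation of words respects the whole congruence, so evaluating a chosen representative is
    independent of the choice and multiplicative. *)
Lemma presented_rep :
  (forall u v, r u v -> word_eval u = word_eval v) ->
  (forall a, f a \o f (a.1, ~~ a.2) = \1)%VF ->
  exists2 rho : presented r -> 'End(V),
    representation rho & forall x, rho (pres_gen r x) = f (letter x).
Proof.
move=> fr fV.
have evP u v : pres_eq r u v -> word_eval u = word_eval v.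
  elim=> {u v} [u v /fr //|a|//|//|u v w _ -> _ -> //|u u' v v' _ uu' _ vv'].
    by rewrite /= comp_lfun1r.
  by rewrite !word_eval_cat uu' vv'.
have evE w : word_eval (pres_repr (pres_class r w)) = word_eval w.
  exact/evP/pres_classP/pres_class_repr.
exists (fun g => word_eval (pres_repr g)) => [|x].
  split=> [|g h]; first exact: evE.
  by rewrite evE word_eval_cat.
by rewrite evE /= comp_lfun1r.
Qed.

End Presented.

(** * The cyclic family of generators in the braid group *)

Section Braid.
Variable n : nat.
Local Open Scope group_scope.
Local Notation sigma := (braid_sigma n).
Local Notation gamma := (braid_gamma n).

Lemma braid_sigma3 i : (0 < i)%N -> (i.+1 < n)%N ->
  sigma i * sigma i.+1 * sigma i = sigma i.+1 * sigma i * sigma i.+1.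
Proof.
move=> i_gt0 i_lt; rewrite /braid_sigma.
have i1 : (0 < i < n)%N by lia.
have i2 : (0 < i.+1 < n)%N by [].
rewrite (insubT (fun i => 0 < i < n)%N i1) (insubT (fun i => 0 < i < n)%N i2) /=.
have /PresRel/pres_classP := @BraidRel3 n (Sub i i1) (Sub i.+1 i2) erefl.
by rewrite !pres_class_cons2 !mulgA.
Qed.

Lemma braid_sigmaC i j : (i.+1 < j)%N -> commute (sigma i) (sigma j).
Proof.
move=> ij; rewrite /braid_sigma.
case: insubP => [i' _ iE|_]; last exact/commute_sym/commute1.
case: insubP => [j' _ jE|_]; last exact/commute1.
have /BraidRelC/PresRel/pres_classP : ((val i').+1 < val j')%N || ((val j').+1 < val i')%N.
  by rewrite iE jE ij.
by rewrite !pres_class_cons2.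
Qed.

(** Write gamma as P sigma_i sigma_(i+1) Q. Then sigma_i commutes with Q and sigma_(i+1) with P, and
    the braid relation acts in the middle. *)
Lemma braid_gamma_sigma i : (0 < i)%N -> (i.+1 < n)%N ->
  gamma * sigma i = sigma i.+1 * gamma.
Proof.
move=> i_gt0 i_lt; rewrite /braid_gamma.
rewrite (@big_cat_nat _ _ _ i) //=; last lia.
rewrite (big_ltn (ltnW i_lt)) (big_ltn i_lt).
set P := \prod_(1 <= _ < i) _; set Q := \prod_(_ <= _ < n) _.
have QC : commute (sigma i) Q.
  by rewrite /Q big_nat; apply: commute_prod => j /andP[ij _]; apply: braid_sigmaC.
have PC : commute (sigma i.+1) P.
  rewrite /P big_nat; apply: commute_prod => j /andP[_ ji].
  exact/commute_sym/braid_sigmaC.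
rewrite -!mulgA -QC !mulgA PC -!mulgA; congr (P * _).
by rewrite !mulgA braid_sigma3.
Qed.

(** With gamma = B sigma_(n-1) = sigma_1 A, the shift gives gamma B = A gamma, hence gamma^2 = A
    gamma sigma_(n-1); multiply by sigma_1 on the left. *)
Lemma braid_gamma2_sigma : (1 < n)%N ->
  gamma * gamma * sigma n.-1 = sigma 1 * gamma * gamma.
Proof.
move=> n_gt1; set B := \prod_(1 <= i < n.-1) sigma i.
have BE : gamma = B * sigma n.-1.
  rewrite /braid_gamma /B; case: n n_gt1 => [|m] //= m_gt0.
  by rewrite big_nat_recr.
set A := \prod_(1 <= i < n.-1) sigma i.+1.
have AE : gamma = sigma 1 * A.
  by rewrite /braid_gamma /A big_ltn // big_add1.
have gB : gamma * B = A * gamma.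
  suff gBk k : (k < n)%N -> gamma * (\prod_(1 <= i < k) sigma i) =
    (\prod_(1 <= i < k) sigma i.+1) * gamma by apply: gBk; lia.
  elim: k => [|k IHk] kn; first by rewrite !big_geq // mulg1 mul1g.
  case: (posnP k) => [->|k_gt0]; first by rewrite !big_geq // mulg1 mul1g.
  by rewrite !big_nat_recr //= mulgA IHk 1?ltnW // -!mulgA braid_gamma_sigma.
have gg : gamma * gamma = A * gamma * sigma n.-1 by rewrite {2}BE mulgA gB.
by rewrite -[RHS]mulgA [in RHS]gg !mulgA -AE.
Qed.

(* Equals sigma_(k+1) for k + 1 < n, and is n-periodic in k. *)
Definition cyclic_sigma k := gamma ^+ k * sigma 1 * gamma ^- k.
Local Notation s := cyclic_sigma.

Lemma cyclic_sigmaD d k : s (d + k) = gamma ^+ k * s d * gamma ^- k.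
Proof. by rewrite /s addnC expgnDr invgM !mulgA. Qed.

Lemma cyclic_sigmaS k : gamma * s k = s k.+1 * gamma.
Proof. by rewrite -addn1 cyclic_sigmaD expg1 mulgVK. Qed.

Lemma cyclic_sigmaE k : (k.+1 < n)%N -> s k = sigma k.+1.
Proof.
elim: k => [|k IHk] kn; first by rewrite /s expg0 invg1 mul1g mulg1.
apply: (mulIg gamma); rewrite -cyclic_sigmaS IHk 1?ltnW //.
exact: braid_gamma_sigma.
Qed.

Hypothesis n_gt1 : (1 < n)%N.

Lemma cyclic_sigma_last : s n.-1 = gamma * sigma n.-1 * gamma^-1.
Proof.
have nE : (n.-2.+1 = n.-1)%N by lia.
by rewrite -{1}nE -addn1 cyclic_sigmaD expg1 cyclic_sigmaE nE //; lia.
Qed.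

(** Conjugation reduces this to [k = 0], which, after multiplication by gamma^2 on the right, is
    [braid_gamma2_sigma]. *)
Lemma cyclic_sigman k : s (k + n) = s k.
Proof.
suff sn : s n = s 0 by rewrite addnC cyclic_sigmaD sn -cyclic_sigmaD add0n.
apply: (mulIg gamma); apply: (mulIg gamma).
have -> : s n = s n.-1.+1 by rewrite prednK // ltnW.
rewrite -cyclic_sigmaS cyclic_sigma_last.
by rewrite cyclic_sigmaE // !mulgA mulgVK braid_gamma2_sigma.
Qed.

Lemma cyclic_sigma_mod k : s (k %% n) = s k.
Proof.
rewrite [in RHS](divn_eq k n) addnC.
by elim: (k %/ n) => [|q IHq]; rewrite ?addn0 // mulSn addnCA addnC cyclic_sigman.
Qed.

(** Conjugation by gamma^n shifts the cyclic index by a full period, so it fixes every generator. *)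
Lemma braid_gammaXC g : commute (gamma ^+ n) g.
Proof.
apply: commute_presented g => i; have /andP[i_gt0 i_lt] := valP i.
have -> : pres_gen (@braid_rel n) i = s (val i).-1.
  by rewrite cyclic_sigmaE ?prednK // /braid_sigma valK.
by rewrite /commute -[in RHS]cyclic_sigman cyclic_sigmaD mulgVK.
Qed.

Lemma cyclic_sigma3 k : s k * s k.+1 * s k = s k.+1 * s k * s k.+1.
Proof.
have conjM x y z : (gamma ^+ k * x * gamma ^- k) * (gamma ^+ k * y * gamma ^- k)
   * (gamma ^+ k * z * gamma ^- k) = gamma ^+ k * (x * y * z) * gamma ^- k.
  by rewrite !mulgA !mulgVK.
rewrite -[k]add0n -addSn !cyclic_sigmaD !conjM; congr (_ * _ * _).
(* For [n = 2] gamma is sigma_1 itself, and the two cyclic generators coincide. *)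
have [n2|n_neq2] := eqVneq n 2; last first.
  by rewrite !cyclic_sigmaE ?braid_sigma3 //; lia.
have -> : s 1 = s 0; last by [].
have n1 : n.-1 = 1%N by rewrite n2.
have gammaE : gamma = sigma 1 by rewrite /braid_gamma n2 big_nat1.
by rewrite -{1}n1 cyclic_sigma_last cyclic_sigmaE // n1 gammaE mulgK.
Qed.

(** Conjugation by gamma^k reduces this to the far commutation of sigma_1 and sigma_(d+1). *)
Lemma cyclic_sigmaC d k : (1 < d)%N -> (d.+1 < n)%N -> commute (s k) (s (d + k)).
Proof.
move=> d_gt1 dn; rewrite /commute -{1 4}[k]add0n !cyclic_sigmaD.
have conjM x y : (gamma ^+ k * x * gamma ^- k) * (gamma ^+ k * y * gamma ^- k) =
   gamma ^+ k * (x * y) * gamma ^- k by rewrite !mulgA mulgVK.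
rewrite !conjM; congr (_ * _ * _).
by rewrite !cyclic_sigmaE //; apply: braid_sigmaC.
Qed.

End Braid.

(** * Indices modulo n and the necklace relations *)

Lemma val_Zp_add1 n (i : 'Z_n) : (1 < n)%N ->
  (i + 1 : 'Z_n)%R = i.+1 %% n :> nat.
Proof. by move=> n_gt1; rewrite /= modnDmr addn1; congr modn; apply: Zp_cast. Qed.

Section NecklaceRep.
Variables (F : fieldType) (V : vectType F) (n : nat).
Variables (rho : braid n -> 'End(V)) (D : 'End(V)).
Hypotheses (n_gt1 : (1 < n)%N) (rhoP : representation rho).
Hypothesis DC : rep_commutes rho D.
Local Notation tau := (D \o rho (braid_gamma n))%VF.
Hypothesis tauX : lfun_exp tau (2 * n) = \1%VF.

(* The shift by n - 1 makes sigma_i the (i - 1)-st cyclic generator. *)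
Local Notation s i := (cyclic_sigma n (nat_of_ord i + n.-1)).

(** Since the 2n-th power of [tau] is the identity, its inverse is its power of exponent 2n - 1. *)
Definition necklace_lfun (a : necklace_index n * bool) : 'End(V) :=
  match a with
  | (Some i, true) => rho (s i)
  | (Some i, false) => rho (s i)^-1%g
  | (None, true) => tau
  | (None, false) => lfun_exp tau (2 * n).-1
  end.

Let sS (i : 'Z_n) : s (i + 1)%R = cyclic_sigma n (i + n.-1).+1.
Proof.
by rewrite val_Zp_add1 // -cyclic_sigma_mod // modnDml cyclic_sigma_mod //.
Qed.

Let sC (i j : 'Z_n) : (i - j != 1)%R -> (i - j != -1)%R -> commute (s i) (s j).
Proof.
have ltn (k : 'Z_n) : (k < n)%N by rewrite -[ltnRHS](Zp_cast n_gt1).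
wlog ij : i j / (i <= j)%N => [IH h1 h2|].
  have [|/ltnW ji] := leqP i j; first by move/IH; apply.
  apply/commute_sym/IH => //; rewrite -opprB ?eqr_opp //.
  by rewrite -[X in _ != X]opprK eqr_opp.
have [/ord_inj -> _ _|neq_ij] := eqVneq (i : nat) j; first exact: commute_refl.
(* It remains to show 2 <= j - i <= n - 2, the range in which cyclic generators commute. *)
move=> h1 h2; have ji2 : (j : nat) != i.+1.
  apply: contraNneq h2 => jE; have -> : j = (i + 1)%R.
    by apply: ord_inj; rewrite val_Zp_add1 // modn_small // -jE.
  by rewrite opprD addrA subrr sub0r.
(* A difference of n - 1 forces i = 0 and j = n - 1, which are neighbours modulo n. *)
have ji3 : (j - i != n.-1)%N.
  apply: contraNneq h1 => jE; have [i0 jn] : i = 0 :> nat /\ j = n.-1 :> nat.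
    by move: (ltn i) (ltn j); lia.
  have -> : i = (j + 1)%R.
    by apply: ord_inj; rewrite val_Zp_add1 // jn prednK ?modnn // ltnW.
  by rewrite addrC addKr.
have -> : (j + n.-1 = (j - i) + (i + n.-1))%N by lia.
by apply: cyclic_sigmaC => //; move: (ltn i) (ltn j); lia.
Qed.

Lemma necklace_rep :
  exists2 rho' : necklace_braid n -> 'End(V), representation rho' &
    forall x, rho' (pres_gen (@necklace_rel n) x) = necklace_lfun (letter x).
Proof.
have nE : (2 * n = (2 * n).-1.+1)%N by lia.
have tauV : (tau \o lfun_exp tau (2 * n).-1 = \1)%VF by rewrite -tauX [in RHS]nE.
apply: presented_rep => [u v|[[i|] []]] /=; last first.
- by rewrite -lfun_expS -nE.
- by [].
- by rewrite -repM // mulVg rhoP.1.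
- by rewrite -repM // mulgV rhoP.1.
case=> {u v} [i|i j h1 h2|i|]; rewrite /= ?comp_lfun1r.
- by rewrite !sS !comp_lfunA -!repM // cyclic_sigma3.
- by rewrite -!repM // sC.
(* For (N1), gamma shifts the index while [D] passes through the image of [rho]; then [tau] cancels
   against its inverse. *)
- rewrite -[RHS]/(rho (s (i + 1)%R)) sS comp_lfunA -(comp_lfunA D) -repM // cyclic_sigmaS repM //.
  by rewrite comp_lfunA DC -!comp_lfunA (comp_lfunA D) tauV comp_lfun1r.
- rewrite -tauX; elim: (2 * n)%N => [|k IHk] //=.
  by rewrite IHk.
Qed.

End NecklaceRep.

Theorem theorem2p2 (R : realType) (n : nat) (V : vectType R[i])
    (rho : braid n -> 'End(V)) :
  (2 <= n)%N ->
  representation rho ->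
  completely_reducible rho ->
  exists D : 'End(V), rep_commutes rho D /\
    exists rho' : necklace_braid n -> 'End(V),
      [/\ representation rho',
          forall i : nat, (0 < i < n)%N ->
            rho' (necklace_sigma n i) = rho (braid_sigma n i),
          rho' (necklace_tau n) = (D \o rho (braid_gamma n))%VF &
          rho' (necklace_sigma n n) =
            (rho (braid_gamma n) \o rho (braid_sigma n n.-1)
               \o rho (braid_gamma n)^-1%g)%VF].
Proof.
move=> n_gt1 rhoP rho_cr.
have gC g : commute (braid_gamma n ^+ (2 * n))%g g.
  by rewrite mulnC expgnA; apply/commute_sym/commuteX/commute_sym/braid_gammaXC.
have n2_gt0 : (0 < 2 * n)%N by lia.
have [D DC DX] := rep_central_root rhoP n2_gt0 gC rho_cr.
exists D; split=> //.
have tauX : lfun_exp (D \o rho (braid_gamma n))%VF (2 * n) = \1%VF.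
  by rewrite lfun_exp_comp // -repX.
have [rho' rho'P rho'E] := necklace_rep n_gt1 rhoP DC tauX.
(* The generator depends on [i] only modulo n; periodicity allows the unreduced index, including
   [i = n]. *)
have sE i : rho' (necklace_sigma n i) = rho (cyclic_sigma n (i + n.-1)).
  rewrite rho'E /= val_Zp_nat // -cyclic_sigma_mod // modnDml.
  by rewrite cyclic_sigma_mod.
exists rho'; split=> // [i /andP[i_gt0 i_lt]||]; last 2 first.
- by rewrite rho'E.
- by rewrite sE addnC cyclic_sigman // cyclic_sigma_last // !repM.
have -> : rho' (necklace_sigma n i) = rho (cyclic_sigma n (i.-1 + n)).
  by rewrite sE; congr (rho (cyclic_sigma n _)); lia.
by rewrite cyclic_sigman // cyclic_sigmaE prednK.
Qed.
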